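(* Fix $K=2$. For every horizon $H\ge1$ there exist base models $M_1$ and $M_2$ and two nested state space partitions $\phi_1,\phi_2$ (all depending on $H$) such that it is information-theoretically impossible for any algorithm to obtain $\mathrm{poly}(d^*,H,K,1/\epsilon,1/\delta)$ sample complexity when an adversary chooses a true environment $M^*$ that is realizable under either $\phi_1$ or $\phi_2$. That is, there is no polynomial $f$ and no algorithm (which may know $H$, $M_1,M_2,\phi_1,\phi_2,\epsilon,\delta$) such that, for all $H\ge 1$, all $\epsilon,\delta\in(0,1)$ and every $M^*$ realizable under $\phi_1$ or under $\phi_2$, with probability at least $1-\delta$ the algorithm outputs a policy $\pi$ with $v^\pi_{M^*}\ge v^*-\epsilon$ using at most $f(d^*,H,K,1/\epsilon,1/\delta)$ trajectories.
   Context: An episodic MDP $M=(\mathcal S,\mathcal A,P,R,H,P_1)$ has state space $\mathcal S$, action space $\mathcal A$, transition kernel $P:\mathcal S\times\mathcal A\to\Delta(\mathcal S)$, reward distribution $R:\mathcal S\times\mathcal A\to\Delta([0,1])$, horizon $H$ and initial distribution $P_1$. A policy is a map $\pi:\mathcal S\times[H]\to\mathcal A$; $v^\pi_M$ is the expected total reward of $\pi$ in $M$, and $v^*=\max_\pi v^\pi_{M^*}$. The total reward $\sum_{h=1}^H r_h$ is assumed to lie in $[0,1]$ almost surely in all MDPs considered and under all policies. Given base MDPs $M_1,\dots,M_K$ sharing $\mathcal S,\mathcal A,H,P_1$ (with kernels $P^k$ and rewards $R^k$) and a feature map $\phi:\mathcal S\times\mathcal A\to\Delta_{d-1}$ (probability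 simplex in $\mathbb R^d$), an MDP $M^*$ with the same $\mathcal S,\mathcal A,H,P_1$ is *realizable under $\phi$* if there is $W\in[0,1]^{K\times d}$ with every column summing to $1$ such that for all $(s,a)$ the transition and reward distributions of $M^*$ are $\sum_{k}[W\phi(s,a)]_kP^k(\cdot|s,a)$ and $\sum_k[W\phi(s,a)]_kR^k(\cdot|s,a)$. A feature map $\phi$ of dimension $d$ is a *partition* if there is a partition $\mathcal S\times\mathcal A=\bigcup_{i\in[d]}\mathcal X_i$ into disjoint sets with $\phi_i(s,a)=\mathbf 1[(s,a)\in\mathcal X_i]$; it is a state space partition if the group depends only on $s$. Partitions $\phi_1,\dots,\phi_N$ with dimensions $d_1\le\dots\le d_N$ are *nested* if for all $i\le j$ and all $(s,a),(s',a')$: $\phi_j(s,a)=\phi_j(s',a')\implies\phi_i(s,a)=\phi_i(s',a')$ (i.e. $\phi_j$ refines $\phi_i$). $d^*$ denotes the smallest dimension $d_i$ among those $\phi_i$ under which $M^*$ is realizable. The learner does not know $M^*$ or $d^*$; it collects trajectories (episodes of length $H$) from $M^*$ with adaptively chosen actions and finally outputs a policy. *)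

(* Defs.v *)
From HB Require Import structures.
From mathcomp Require Import all_boot all_order all_algebra.
From mathcomp Require Import all_classical all_reals all_analysis.
From mathcomp Require mpoly.
Set Implicit Arguments.
Unset Strict Implicit.
Unset Printing Implicit Defensive.
Import Order.TTheory GRing.Theory Num.Theory.
Local Open Scope classical_set_scope.
Local Open Scope ring_scope.

Definition is_distr (R : realType) (T : finType) (p : T -> R) : Prop :=
  (forall x, 0 <= p x) /\ \sum_x p x = 1.

(* The horizon H is not a field: it is an argument of the notions below. *)
Record mdp (R : realType) (S A : finType) := MDP {
  init : S -> R;
  trans : S -> A -> S -> R;
  reward : S -> A -> probability (measurableTypeR R) R;
  init_distr : is_distr init;
  trans_distr : forall s a, is_distr (trans s a);
  reward_unit : forall s a, reward s a `[0, 1]%classic = 1%E }.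

Notation step R S A := (S * A * R)%type.

(* Deterministic, nonstationary policies; the stages are numbered from 0. *)
Notation policy S A H := {ffun S * 'I_H -> A}.

Section Interaction.
Context {R : realType} {S A : finType}.
Implicit Types (M : mdp R S A) (hist : seq (step R S A)).

(* Expectation of F over the next k steps of M, started in state s after the
   history hist, when the action in state s after the history hist is drawn
   from act hist s.  The new steps are appended to hist. *)
Fixpoint expect_steps M (act : seq (step R S A) -> S -> A -> R)
    (F : seq (step R S A) -> \bar R) (k : nat) (s : S) hist : \bar R :=
  if k is k'.+1 then
    (\sum_(a : A) (act hist s a)%:E *
      \int[reward M s a]_r \sum_(s' : S) (trans M s a s')%:E *
        expect_steps M act F k' s' (rcons hist (s, a, r)))%E
  else F hist.

Definition expect_episode M (H : nat) (act : seq (step R S A) -> S -> A -> R)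
    (F : seq (step R S A) -> \bar R) hist : \bar R :=
  (\sum_(s : S) (init M s)%:E * expect_steps M act F H s hist)%E.

(* At stage h of an episode the history of that episode has size h. *)
Definition policy_act (H : nat) (pi : policy S A H) hist (s : S) (a : A) : R :=
  if insub (size hist) is Some h then (a == pi (s, h))%:R else 0.

Definition total_reward hist : R := \sum_(x <- hist) x.2.

Definition value M (H : nat) (pi : policy S A H) : \bar R :=
  expect_episode M H (policy_act pi) (fun hist => (total_reward hist)%:E) [::].

Definition opt_value M (H : nat) : \bar R :=
  \big[Order.max/-oo%E]_(pi : policy S A H) value M pi.

(* "Almost surely" is expressed as: the indicator has expectation 1. *)
Definition unit_return M (H : nat) : Prop :=
  forall pi : policy S A H,
    expect_episode M H (policy_act pi)
      (fun hist => (0 <= total_reward hist <= 1)%R%:R%:E) [::] = 1%E.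

(* A randomized algorithm.  Its history is the concatenation of the steps of
   all the episodes so far, so the position in the current episode is the size
   of the history modulo H.  Between two episodes, decide gives the probability
   of playing one more episode (None), or of stopping with output pi (Some pi).
   Both maps are Borel functions of the observed rewards. *)
Record algorithm (H : nat) := Algorithm {
  act : seq (step R S A) -> S -> A -> R;
  decide : seq (step R S A) -> option (policy S A H) -> R;
  act_distr : forall hist s, is_distr (act hist s);
  decide_distr : forall hist, is_distr (decide hist);
  act_measurable : forall n (x : n.-tuple (S * A)) s a,
    measurable_fun [set: n.-tuple (measurableTypeR R)]
      (fun r : n.-tuple (measurableTypeR R) =>
         act (zip x r) s a : measurableTypeR R);
  decide_measurable : forall n (x : n.-tuple (S * A)) o,
    measurable_fun [set: n.-tuple (measurableTypeR R)]
      (fun r : n.-tuple (measurableTypeR R) =>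
         decide (zip x r) o : measurableTypeR R) }.

(* Probability that, continuing after hist, the algorithm stops within n more
   episodes and outputs a policy satisfying good. *)
Fixpoint prob_output M (H : nat) (alg : algorithm H)
    (good : pred (policy S A H)) (n : nat) hist : \bar R :=
  (\sum_(pi | good pi) (decide alg hist (Some pi))%:E +
   (if n is n'.+1 then
      (decide alg hist None)%:E *
        expect_episode M H (act alg) (prob_output M alg good n') hist
    else 0))%E.

Definition eps_optimal M (H : nat) (eps : R) (pi : policy S A H) : bool :=
  (opt_value M H - eps%:E <= value M pi)%E.

Definition realizable (K d : nat) (Mb : 'I_K -> mdp R S A)
    (phi : S -> A -> 'cV[R]_d) M : Prop :=
  (forall k s, init M s = init (Mb k) s) /\
  exists W : 'M[R]_(K, d),
    [/\ forall k i, 0 <= W k i <= 1,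
        forall i, \sum_k W k i = 1,
        forall s a s', trans M s a s' =
          \sum_k (W *m phi s a) k ord0 * trans (Mb k) s a s' &
        forall s a (B : set (measurableTypeR R)), measurable B ->
          (reward M s a B =
           \sum_k ((W *m phi s a) k ord0)%:E * reward (Mb k) s a B)%E].

Definition is_partition (d : nat) (phi : S -> A -> 'cV[R]_d) : Prop :=
  exists X : 'I_d -> {set S * A},
    [/\ forall i, exists x, x \in X i,
        forall i j x, x \in X i -> x \in X j -> i = j,
        forall x, exists i, x \in X i &
        forall s a i, phi s a i ord0 = ((s, a) \in X i)%:R].

Definition is_state_partition (d : nat) (phi : S -> A -> 'cV[R]_d) : Prop :=
  is_partition phi /\ forall s a a', phi s a = phi s a'.

Definition nested (N : nat) (d : 'I_N -> nat)
    (phi : forall i : 'I_N, S -> A -> 'cV[R]_(d i)) : Prop :=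
  forall i j : 'I_N, (i <= j)%N ->
    (d i <= d j)%N /\
    forall s a s' a', phi j s a = phi j s' a' -> phi i s a = phi i s' a'.

Definition is_dstar (K N : nat) (Mb : 'I_K -> mdp R S A) (d : 'I_N -> nat)
    (phi : forall i : 'I_N, S -> A -> 'cV[R]_(d i)) M (ds : nat) : Prop :=
  (exists2 i, realizable Mb (phi i) M & d i = ds) /\
  forall i, realizable Mb (phi i) M -> (ds <= d i)%N.

End Interaction.

Arguments algorithm : clear implicits.

(* f(d, H, K, 1/eps, 1/delta) for a polynomial f in five variables. *)
Definition eval5 (R : realType) (f : mpoly.mpoly 5 R)
    (d H K : nat) (eps delta : R) : R :=
  mpoly.meval
    (fun i : 'I_5 => [:: d%:R; H%:R; K%:R; eps^-1; delta^-1]`_i) f.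

(* Main.v *)
Require Import Defs.
From mathcomp Require Import all_boot all_order all_algebra.
From mathcomp Require Import all_classical all_reals all_analysis.
From mathcomp Require Import measurable_realfun.
From mathcomp Require mpoly.
From mathcomp Require Import lra zify.
Local Open Scope ring_scope.

Set Implicit Arguments.
Unset Strict Implicit.
Unset Printing Implicit Defensive.
Import Order.TTheory GRing.Theory Num.Theory.

(* Let S = A have H^H + 1 elements and let the action name the next state.  Every
   state pays nothing in M_1 and 1/H in M_2.  Let phi_1 have a single class and
   phi_2 separate all states.  Then M_1 is realizable under phi_1, so that d* = 1,
   and the model M_l in which only the state l pays 1/H is realizable under phi_2.
   Run on M_1, the algorithm must stop after n <= poly(H) episodes with
   probability 3/4; in these it visits at most nH states, and the policy it
   outputs visits at most H.  As long as l is not visited, M_l cannot be told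
   apart from M_1, and a policy that never visits l is not 1/4-optimal in M_l.
   Summing the success probabilities over l gives
     (3/4) |S| <= H (n^2 + 1) + (1/4) |S|,
   which fails for large H as |S| > H^H. *)

(** * Integration against a Dirac mass *)

Section DiracIntegral.
Import HBNNSimple.
Context (disp : measure_display) (T : measurableType disp) (R : realType).
Variables (a : T) (ma : measurable [set a]%classic).

(* As the point [a] is measurable, simple functions supported there suffice,
   and [f] need not be measurable. *)
Lemma ge0_integral_dirac_point (f : T -> \bar R) :
  (forall x, (0 <= f x)%E) -> (\int[dirac a]_x f x)%E = f a.
Proof.
move=> f0; rewrite ge0_integralTE//.
have sintE (h : {nnsfun T >-> R}) : sintegral (dirac a) h = (h a)%:E.
  rewrite -integralT_nnsfun integral_dirac//; first by rewrite diracT mul1e.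
  exact/measurable_EFinP.
apply/eqP; rewrite eq_le; apply/andP; split.
  by apply: ge_ereal_sup => _ [h /= hf <-]; rewrite sintE; exact: hf.
have lb (r : R) : 0 <= r -> (r%:E <= f a)%E ->
    (r%:E <= ereal_sup [set sintegral (dirac a) h |
       h in [set h : {nnsfun T >-> R} | (forall x, (h x)%:E <= f x)%E]])%E.
  move=> r0 rf; apply: ereal_sup_ubound => /=.
  exists (scale_nnsfun (indic_nnsfun R ma) r0) => [x /=|].
    rewrite mindicE; have [/set_mem ->|_] := boolP (x \in [set a]%classic).
      by rewrite mulr1.
    by rewrite mulr0.
  by rewrite sintE /= mindicE mem_set// mulr1.
case fa : (f a) => [r||].
- by apply: lb; rewrite ?fa// -lee_fin -fa.
- rewrite leye_eq; apply/eqP/eqyP => r r0.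
  by apply: lb; rewrite ?(ltW r0)// fa leey.
- exact: leNye.
Qed.

(** The positive and negative parts are evaluated separately. This computes the reward integrals in
    [expect_steps] for any continuation as integrand. *)
Lemma integral_dirac_point (f : T -> \bar R) : (\int[dirac a]_x f x)%E = f a.
Proof.
by rewrite integralE !ge0_integral_dirac_point// [in RHS](funeposneg f).
Qed.

End DiracIntegral.

(** * Hop models and their expectations as finite sums *)

Section Hop.
Context (R : realType) (T : finType) (s0 : T) (H : nat).
Implicit Types (L : {set T}) (hist : seq (step R T T)) (pi : policy T T H).

Lemma is_distr_delta (a : T) : is_distr (fun x => (x == a)%:R : R).
Proof.
split=> [x|]; first by rewrite ler0n.
by rewrite (bigD1 a)//= eqxx big1 ?addr0// => x /negbTE ->.
Qed.

(* Junk value [0] for [H = 0], as [0^-1 = 0]. *)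
Definition hop_reward L (s : T) : R := (s \in L)%:R / H%:R.

Lemma hop_reward_ge0 L s : 0 <= hop_reward L s.
Proof. by rewrite divr_ge0. Qed.

Lemma hop_reward_le L s : hop_reward L s <= H%:R^-1.
Proof. by rewrite ler_piMl ?invr_ge0 ?lern1 ?leq_b1. Qed.

Lemma dirac_hop_reward_unit L s :
  dirac (hop_reward L s : measurableTypeR R) `[0, 1]%classic = 1%E :> \bar R.
Proof.
rewrite diracE mem_set//= in_itv/= hop_reward_ge0.
rewrite (le_trans (hop_reward_le _ _))//.
by case: H => [|h]; rewrite ?invr0// invf_le1// ler1n.
Qed.

Definition hop L : mdp R T T := {|
  init := fun s => (s == s0)%:R;
  trans := fun _ a s' => (s' == a)%:R;
  reward := fun s _ => dirac (hop_reward L s : measurableTypeR R);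
  init_distr := is_distr_delta s0;
  trans_distr := fun _ a => is_distr_delta a;
  reward_unit := fun s _ => dirac_hop_reward_unit L s |}.

(** What is left of [expect_steps] when state [s] pays exactly [c s] and the action names the next
    state: only the choice of actions is averaged. *)
Fixpoint hop_steps (c : T -> R) (act : seq (step R T T) -> T -> T -> R)
    (F : seq (step R T T) -> R) (k : nat) (s : T) hist : R :=
  if k is k'.+1 then
    \sum_a act hist s a * hop_steps c act F k' a (rcons hist (s, a, c s))
  else F hist.

Lemma sum_deltaE (a : T) (f : T -> \bar R) :
  (\sum_x ((x == a)%:R : R)%:E * f x = f a)%E.
Proof.
rewrite (bigD1 a)//= eqxx mul1e big1 ?adde0// => x /negbTE ->.
by rewrite mul0e.
Qed.

Lemma expect_steps_hop L act F k s hist :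
  expect_steps (hop L) act (fun h => (F h)%:E) k s hist =
  (hop_steps (hop_reward L) act F k s hist)%:E.
Proof.
elim: k s hist => [|k IH] s hist //=.
rewrite -sumEFin; apply: eq_bigr => a _; rewrite EFinM; congr (_ * _)%E.
by rewrite integral_dirac_point// sum_deltaE IH.
Qed.

Lemma expect_episode_hop L act F hist :
  expect_episode (hop L) H act (fun h => (F h)%:E) hist =
  (hop_steps (hop_reward L) act F H s0 hist)%:E.
Proof. by rewrite /expect_episode sum_deltaE expect_steps_hop. Qed.

Fixpoint hop_output (c : T -> R) (alg : algorithm R T T H)
    (good : pred (policy T T H)) (n : nat) hist : R :=
  \sum_(pi | good pi) decide alg hist (Some pi) +
  if n is n'.+1 then
    decide alg hist None *
      hop_steps c (act alg) (hop_output c alg good n') H s0 hist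
  else 0.

Lemma prob_output_hop L alg good n hist :
  prob_output (hop L) alg good n hist =
  (hop_output (hop_reward L) alg good n hist)%:E.
Proof.
elim: n hist => [|n IH] hist /=; rewrite EFinD -sumEFin//.
rewrite (_ : prob_output _ _ _ _ = fun h =>
  (hop_output (hop_reward L) alg good n h)%:E); last exact/funext.
by rewrite expect_episode_hop EFinM.
Qed.

(** * Monotonicity and linearity of averages over an episode *)

Section Average.
Variables (c : T -> R) (act : seq (step R T T) -> T -> T -> R).
Hypothesis act_distr : forall hist s, is_distr (act hist s).

Lemma act_ge0 hist s a : 0 <= act hist s a.
Proof. by have [] := act_distr hist s. Qed.

Lemma act_mean hist s (x : R) : \sum_a act hist s a * x = x.
Proof. by rewrite -mulr_suml (act_distr hist s).2 mul1r. Qed.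

(** Only extensions of [hist] by [k] steps are compared, so bounds may use the length of the history
    and the states already in [hist]. *)
Lemma hop_steps_le F G k s hist :
  (forall h, size h = k -> F (hist ++ h) <= G (hist ++ h)) ->
  hop_steps c act F k s hist <= hop_steps c act G k s hist.
Proof.
elim: k s hist => [|k IH] s hist FG /=.
  by have := FG [::] erefl; rewrite cats0.
apply: ler_sum => a _; rewrite ler_wpM2l ?act_ge0//.
by apply: IH => h hk; rewrite -cats1 -catA; apply: FG; rewrite /= hk.
Qed.

Lemma hop_steps_cst x k s hist : hop_steps c act (fun=> x) k s hist = x.
Proof.
elim: k s hist => [|k IH] s hist //=.
by under eq_bigr do rewrite IH; exact: act_mean.
Qed.

Lemma hop_stepsD F G k s hist :
  hop_steps c act (fun h => F h + G h) k s hist =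
  hop_steps c act F k s hist + hop_steps c act G k s hist.
Proof.
elim: k s hist => [|k IH] s hist //=.
by rewrite -big_split; apply: eq_bigr => a _; rewrite IH mulrDr.
Qed.

Lemma hop_stepsN F k s hist :
  hop_steps c act (fun h => - F h) k s hist = - hop_steps c act F k s hist.
Proof.
elim: k s hist => [|k IH] s hist //=.
by rewrite -sumrN; apply: eq_bigr => a _; rewrite IH mulrN.
Qed.

Lemma hop_steps_sum (I : finType) (F : I -> seq (step R T T) -> R) k s hist :
  hop_steps c act (fun h => \sum_i F i h) k s hist =
  \sum_i hop_steps c act (F i) k s hist.
Proof.
elim: k s hist => [|k IH] s hist //=.
by rewrite exchange_big; apply: eq_bigr => a _; rewrite IH mulr_sumr.
Qed.

Lemma hop_steps_le1 F k s hist :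
  (forall h, F h <= 1) -> hop_steps c act F k s hist <= 1.
Proof.
by move=> F1; rewrite -(hop_steps_cst 1 k s hist); exact: hop_steps_le.
Qed.

Lemma hop_steps_ge0 F k s hist :
  (forall h, 0 <= F h) -> 0 <= hop_steps c act F k s hist.
Proof.
by move=> F0; rewrite -(hop_steps_cst 0 k s hist); exact: hop_steps_le.
Qed.

End Average.

(** * Coupling of the models with one and with no paying state *)

Definition visited hist : seq T := [seq x.1.1 | x <- hist].

(* [hop [set l]] and [hop set0] generate the same histories until [l] is
   visited. *)
Lemma hop_steps_coupling act (F G : seq (step R T T) -> R) l k s hist :
  (forall h s, is_distr (act h s)) ->
  (forall h, F h <= 1) -> (forall h, 0 <= G h) ->
  (forall h, l \notin visited h -> F h <= G h) ->
  l \notin visited hist ->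
  hop_steps (hop_reward [set l]%SET) act F k s hist <=
  hop_steps (hop_reward finset.set0) act (fun h => (l \in visited h)%:R + G h)
    k s hist.
Proof.
move=> distr F1 G0 FG; elim: k s hist => [|k IH] s hist lh /=.
  by rewrite (negbTE lh) add0r FG.
apply: ler_sum => a _; rewrite ler_wpM2l ?act_ge0//.
have [->|sl] := eqVneq s l; last first.
  have -> : hop_reward [set l]%SET s = hop_reward finset.set0 s.
    by rewrite /hop_reward finset.in_set1 finset.in_set0 (negbTE sl).
  by apply: IH; rewrite /visited map_rcons mem_rcons inE negb_or eq_sym sl.
(* The step taken from [l] reveals its reward, and the two runs part. The left side is at most 1,
   while on the right the indicator is 1 for every extension of [h']. *)
apply: (@le_trans _ _ 1); first exact: hop_steps_le1.
set h' := rcons _ _; set c := hop_reward finset.set0.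
rewrite -[leLHS](hop_steps_cst c distr 1 k a h').
apply: hop_steps_le => // h _.
rewrite {1}/visited map_cat map_rcons mem_cat mem_rcons mem_head.
by rewrite /= lerDl G0.
Qed.

(** * Success probabilities summed over the paying state *)

Section Exposure.
Variable alg : algorithm R T T H.
Implicit Type good : pred (policy T T H).

Lemma decide_ge0 hist o : 0 <= decide alg hist o.
Proof. by have [] := decide_distr alg hist. Qed.

Lemma decide_sum hist :
  decide alg hist None + \sum_pi decide alg hist (Some pi) = 1.
Proof.
have [_ <-] := decide_distr alg hist; rewrite [RHS](bigD1 None)//=.
congr (_ + _); rewrite [RHS](reindex_omap Some id)/= => [|[]//].
by apply: eq_bigl => pi; rewrite eqxx.
Qed.

Lemma decide_good_le good hist :
  \sum_(pi | good pi) decide alg hist (Some pi) <=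
  \sum_pi decide alg hist (Some pi).
Proof.
rewrite [leRHS](bigID good)/= lerDl sumr_ge0// => pi _; exact: decide_ge0.
Qed.

Lemma hop_output_le1 c good n hist : hop_output c alg good n hist <= 1.
Proof.
elim: n hist => [|n IH] hist /=; have := decide_sum hist;
  have := decide_good_le good hist; have := decide_ge0 hist None; first lra.
have := hop_steps_le1 c (act_distr alg) H s0 hist IH; nra.
Qed.

(* Under the zero reward, bounds the probability that within [n] episodes [l]
   is visited or a policy satisfying [good] is output; a visited state counts
   once for its episode and once more for every later one. *)
Fixpoint exposure good (l : T) (n : nat) hist : R :=
  \sum_(pi | good pi) decide alg hist (Some pi) +
  if n is n'.+1 then
    decide alg hist None *
      hop_steps (hop_reward finset.set0) (act alg)
        (fun h => (l \in visited h)%:R + exposure good l n' h) H s0 hist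
  else 0.

Lemma exposure_ge0 good l n hist : 0 <= exposure good l n hist.
Proof.
have dec0 h : 0 <= \sum_(pi | good pi) decide alg h (Some pi).
  by apply: sumr_ge0 => pi _; exact: decide_ge0.
elim: n hist => [|n IH] hist /=; first by rewrite addr0.
rewrite addr_ge0// mulr_ge0 ?decide_ge0// hop_steps_ge0 => [//||h].
  exact: act_distr.
by rewrite addr_ge0.
Qed.

(** Until [l] is visited the two runs agree, so success requires that [l] be exposed within [n]
    episodes or that the zero-reward run be still going after them. The last term pays for the
    latter, which leaves [m] unrelated to [n]. *)
Lemma hop_output_le_exposure good l m n hist : l \notin visited hist ->
  hop_output (hop_reward [set l]%SET) alg good m hist <=
  exposure good l n hist
  + (1 - hop_output (hop_reward finset.set0) alg predT n hist).
Proof.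
elim: n m hist => [|n IH] m hist lh.
  (* For [n = 0] the last term is the probability of not stopping now, which covers whatever happens
     in later episodes. *)
  have := decide_sum hist; have := decide_ge0 hist None.
  case: m => [|m] /=; first lra.
  set X := hop_steps _ _ _ _ _ _; suff : X <= 1 by nra.
  apply: hop_steps_le1; [exact: act_distr|move=> h; exact: hop_output_le1].
case: m => [|m].
  have := hop_output_le1 (hop_reward finset.set0) predT n.+1 hist.
  rewrite [X in _ -> X <= _]/= [exposure _ _ _ _]/=.
  set X := hop_steps _ _ _ _ _ _.
  suff : 0 <= X by have := decide_ge0 hist None; nra.
  apply: hop_steps_ge0; [exact: act_distr|move=> h].
  by rewrite addr_ge0// exposure_ge0.
have := decide_sum hist; have := decide_ge0 hist None => /=.
set X := hop_steps (hop_reward [set l]%SET) _ _ _ _ _.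
set Y := hop_steps (hop_reward finset.set0) _ _ _ _ _.
set Z := hop_steps (hop_reward finset.set0) _ _ _ _ _.
suff : X <= Y + (1 - Z) by nra.
(* Averaging the constant 1 as well puts the right side under a single [hop_steps], in the shape the
   coupling requires. *)
have -> : Y + (1 - Z) = hop_steps (hop_reward finset.set0) (act alg) (fun h =>
    (l \in visited h)%:R + (exposure good l n h +
    (1 - hop_output (hop_reward finset.set0) alg predT n h))) H s0 hist.
  rewrite -[X in Y + (X - Z)](hop_steps_cst (hop_reward finset.set0)
    (act_distr alg) 1 H s0 hist).
  rewrite -hop_stepsN -!hop_stepsD; congr hop_steps.
  by apply/funext => h; rewrite -addrA.
apply: hop_steps_coupling => // [|h|h|h lvh].
- exact: act_distr.
- exact: hop_output_le1.
- by rewrite addr_ge0 ?exposure_ge0// subr_ge0 hop_output_le1.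
- exact: IH.
Qed.

Lemma sum_mem_le (s : seq T) : \sum_l (l \in s)%:R <= (size s)%:R :> R.
Proof. by rewrite -natr_sum ler_nat -big_mkcond sum1_card card_size. Qed.

(** Each of the [n] episodes contributes at most the length of the history at its end, hence at most
    [size hist + n * H]. The remaining [H] is for the output: a single policy, good for at most [H]
    states [l]. *)
Lemma sum_exposure_le (good : T -> pred (policy T T H)) n hist :
  (forall pi, \sum_l (good l pi)%:R <= H%:R :> R) ->
  \sum_l exposure (good l) l n hist <= (H + n * (size hist + n * H))%:R.
Proof.
move=> goodH.
have sumgood h : \sum_l \sum_(pi | good l pi) decide alg h (Some pi) <=
    H%:R * \sum_pi decide alg h (Some pi).
  under eq_bigr do rewrite big_mkcond/=.
  rewrite exchange_big mulr_sumr; apply: ler_sum => pi _ /=.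
  apply: le_trans (ler_wpM2r (decide_ge0 h (Some pi)) (goodH pi)).
  by rewrite mulr_suml; apply: ler_sum => l _; case: ifP; rewrite ?mul1r ?mul0r.
elim: n hist => [|n IH] hist /=; rewrite big_split/=.
  rewrite mul0n addn0 big1_eq addr0 (le_trans (sumgood hist))// ler_piMr//.
  by have := decide_sum hist; have := decide_ge0 hist None; lra.
rewrite -mulr_sumr -hop_steps_sum.
set X := hop_steps _ _ _ _ _ _.
(* The first summand bounds the states visited by the end of the coming episode; the second is the
   induction hypothesis after it. *)
pose b : R := ((size hist + H) + (H + n * ((size hist + H) + n * H)))%:R.
have Xb : X <= b.
  rewrite -(hop_steps_cst (hop_reward finset.set0) (act_distr alg) b H s0 hist).
  apply: hop_steps_le; [exact: act_distr|move=> h hH].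
  rewrite big_split/= /b natrD -hH -size_cat lerD//.
    by rewrite (le_trans (sum_mem_le _))// size_map.
  by rewrite hH; exact: IH.
have := decide_sum hist; have := decide_ge0 hist None.
set q := decide _ _ _; set d := (X in _ + X = 1).
move=> q0 qd; have gH : _ <= H%:R * d := sumgood hist.
have d0 : 0 <= d by apply: sumr_ge0 => pi _; exact: decide_ge0.
have bB : b <= (n.+1 * (size hist + n.+1 * H))%:R + H%:R.
  by rewrite -natrD ler_nat; nia.
rewrite natrD.
set B : R := (n.+1 * _)%:R in bB *.
(* Stopping now contributes at most [H * d], continuing at most [q * (B + H)]; as [d + q = 1], the
   total is at most [H + B]. *)
have qX : q * X <= q * (B + H%:R) by rewrite ler_wpM2l// (le_trans Xb).
have Bd : 0 <= B * d by rewrite mulr_ge0.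
move: gH Bd; have -> : d = 1 - q by lra.
set g := \sum_l _; lra.
Qed.

End Exposure.

(** From the empty history the exposures sum to at most [H + n * (n * H)]. Each [l] keeps its own
    number of episodes [m l]; only the zero-reward run is held to [n]. *)
Lemma sum_hop_output_le (alg : algorithm R T T H)
    (good : T -> pred (policy T T H)) (m : T -> nat) n :
  (forall pi, \sum_l (good l pi)%:R <= H%:R :> R) ->
  \sum_l hop_output (hop_reward [set l]%SET) alg (good l) (m l) [::] <=
  (H * (n ^ 2).+1)%:R
  + #|T|%:R * (1 - hop_output (hop_reward finset.set0) alg predT n [::]).
Proof.
move=> goodH; apply: (@le_trans _ _ (\sum_l (exposure alg (good l) l n [::] +
    (1 - hop_output (hop_reward finset.set0) alg predT n [::])))).
  by apply: ler_sum => l _; exact: hop_output_le_exposure.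
rewrite big_split/= sumr_const [in leRHS]mulr_natl lerD2r.
apply: le_trans (sum_exposure_le alg n [::] goodH) _.
by rewrite ler_nat/= add0n mulnS mulnA mulnn mulnC.
Qed.

(** * Trajectories and returns of policies *)

Fixpoint hop_path pi (k : nat) (s : T) (h : nat) : seq T :=
  if k is k'.+1 then
    if insub h is Some i then s :: hop_path pi k' (pi (s, i)) h.+1 else [::]
  else [::].

Lemma size_hop_path pi k s h : (size (hop_path pi k s h) <= k)%N.
Proof. by elim: k s h => [|k IH] s h //=; case: insub => //= i; exact: IH. Qed.

Lemma hop_path_const l k s h : (h + k.+1 = H)%N ->
  hop_path [ffun=> l] k.+1 s h = s :: nseq k l.
Proof.
elim: k s h => [|k IH] s h hH; have lt : (h < H)%N by lia.
  by rewrite /= (insubT (fun i => (i < H)%N) lt).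
rewrite /= (insubT (fun i => (i < H)%N) lt) ffunE.
by have /= -> := IH l h.+1; last lia.
Qed.

(** A policy gives weight 1 to one action, so the average collapses to one trajectory. A general [F]
    serves both [value] and the indicator in [unit_return]. *)
Lemma hop_steps_policy c pi (F : R -> R) k s hist : (size hist + k = H)%N ->
  hop_steps c (policy_act pi) (fun h => F (total_reward h)) k s hist =
  F (total_reward hist + \sum_(x <- hop_path pi k s (size hist)) c x).
Proof.
elim: k s hist => [|k IH] s hist hH /=; first by rewrite big_nil addr0.
have lt : (size hist < H)%N by lia.
rewrite /policy_act (insubT (fun i => (i < H)%N) lt) big_cons addrA.
rewrite (bigD1 (pi (s, Sub (size hist) lt)))//= eqxx mul1r big1 ?addr0.
  rewrite IH size_rcons; last lia.
  by rewrite /total_reward -cats1 big_cat/= big_seq1.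
by move=> a /negbTE ->; rewrite mul0r.
Qed.

Definition hop_return L pi : R :=
  \sum_(x <- hop_path pi H s0 0) hop_reward L x.

Lemma expect_return_hop L pi (F : R -> R) :
  expect_episode (hop L) H (policy_act pi)
    (fun h => (F (total_reward h))%:E) [::] = (F (hop_return L pi))%:E.
Proof.
by rewrite expect_episode_hop hop_steps_policy// /total_reward big_nil add0r.
Qed.

Lemma value_hop L pi : value (hop L) pi = (hop_return L pi)%:E.
Proof. exact: (expect_return_hop L pi id). Qed.

Lemma hop_return_ge0 L pi : 0 <= hop_return L pi.
Proof. by apply: sumr_ge0 => x _; exact: hop_reward_ge0. Qed.

Lemma hop_return_le1 L pi : hop_return L pi <= 1.
Proof.
apply: (@le_trans _ _ (\sum_(x <- hop_path pi H s0 0) H%:R^-1)).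
  by apply: ler_sum => x _; exact: hop_reward_le.
rewrite big_const_seq count_predT iter_addr_0 -[leLHS]mulr_natl.
have [->|Hgt0] := posnP H; first by rewrite invr0 mulr0 ler01.
by rewrite ler_pdivrMr ?ltr0n// mul1r ler_nat size_hop_path.
Qed.

Lemma unit_return_hop L : unit_return (hop L) H.
Proof.
move=> pi; rewrite (expect_return_hop L pi (fun x => (0 <= x <= 1)%R%:R)).
by rewrite hop_return_ge0 hop_return_le1.
Qed.

Lemma hop_return_set0 pi : hop_return finset.set0 pi = 0.
Proof.
by rewrite /hop_return big1// => x _; rewrite /hop_reward finset.in_set0 mul0r.
Qed.

Lemma eps_optimal_hop_set0 eps pi :
  0 <= eps -> eps_optimal (hop finset.set0) eps pi.
Proof.
move=> eps0; rewrite /eps_optimal value_hop hop_return_set0 leeBlDr// add0e.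
apply: bigmax_le => [|pi' _]; first exact: leNye.
by rewrite value_hop hop_return_set0 lee_fin.
Qed.

(* A policy avoiding [l] earns nothing, whereas always moving to [l] earns at
   least [(H - 1) / H]. *)
Lemma eps_optimal_hop_set1 l eps pi : (1 < H)%N -> eps < 2^-1 ->
  eps_optimal (hop [set l]%SET) eps pi -> l \in hop_path pi H s0 0.
Proof.
move=> H1 eps2; apply: contraTT => lpi.
rewrite /eps_optimal value_hop /hop_return big_seq big1; last first.
  move=> x xpi; rewrite /hop_reward finset.in_set1.
  by case: eqVneq xpi lpi => [-> ->|]; rewrite ?mul0r.
rewrite -ltNge lteBrDr// add0e; apply: lt_le_trans (_ : (2^-1)%:E <= _)%E.
  by rewrite lte_fin.
apply: (bigmax_sup [ffun=> l]) => //; rewrite value_hop lee_fin /hop_return.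
have -> : hop_path [ffun=> l] H s0 0 = s0 :: nseq H.-1 l.
  rewrite -(@hop_path_const l H.-1 s0 0); last lia.
  congr hop_path; lia.
rewrite big_cons big_nseq iter_addr_0 [X in _ + X *+ _]/hop_reward.
rewrite finset.in_set1 eqxx mul1r -[X in _ + X]mulr_natl.
(* The payoff of [s0] is dropped; the other [H - 1] states pay [(H - 1) / H], at least 1/2 because
   [1 < H]. *)
rewrite ler_wpDl ?hop_reward_ge0// ler_pdivlMr ?ltr0n; last lia.
rewrite mulrC ler_pdivrMr// -natrM ler_nat; lia.
Qed.

End Hop.

(** * State partitions and realizable hop models *)

Section Realizability.
Context (R : realType).

(** One-hot encoding of the class index [g s]. *)
Definition index_feature (S A : Type) (g : S -> nat) (d : nat)
    (s : S) (a : A) : 'cV[R]_d := \col_j (j == g s :> nat)%:R.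

Lemma index_featureE (S A : Type) (g : S -> nat) d s (a : A) (j : 'I_d) k :
  index_feature g d s a j k = (j == g s :> nat)%:R.
Proof. by rewrite mxE. Qed.

Lemma index_feature_state_partition (S A : finType) (a0 : A) (g : S -> nat) d :
  (forall s, (g s < d)%N) -> (forall j : 'I_d, exists s, g s = j) ->
  is_state_partition (@index_feature S A g d).
Proof.
move=> gd gsurj; split=> [|s a a']; last by apply/matrixP => j k; rewrite !mxE.
exists (fun j => [set x | (j == g x.1 :> nat)]%SET); split.
- by move=> j; have [s gs] := gsurj j; exists (s, a0); rewrite finset.inE/= gs.
- move=> i j x; rewrite !finset.inE => /eqP ix /eqP jx.
  by apply: val_inj; rewrite /= ix.
- by move=> x; exists (Ordinal (gd x.1)); rewrite finset.inE/=.
- by move=> s a i; rewrite index_featureE finset.inE.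
Qed.

Lemma index_feature_inj (S A : Type) (g : S -> nat) d (s s' : S)
    (a a' : A) :
  (g s < d)%N -> index_feature g d s a = index_feature g d s' a' -> g s = g s'.
Proof.
move=> gd /matrixP /(_ (Ordinal gd) ord0); rewrite !mxE/= eqxx.
by case: eqVneq => // _ /eqP; rewrite oner_eq0.
Qed.

Lemma mulmx_index_feature (S A : Type) (g : S -> nat) d K (W : 'M[R]_(K, d))
    s (a : A) (gd : (g s < d)%N) k :
  (W *m index_feature g d s a) k ord0 = W k (Ordinal gd).
Proof.
rewrite mxE (bigD1 (Ordinal gd))//= mxE eqxx mulr1 big1 ?addr0// => j jg.
by rewrite mxE -[g s]/(val (Ordinal gd)) val_eqE (negbTE jg) mulr0.
Qed.

Definition hop_base (T : finType) (s0 : T) (H : nat) (k : 'I_2) : mdp R T T :=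
  hop R s0 H (if k == ord0 then finset.set0 else finset.setT).

(** If the paying set is a union of classes, a 0-1 matrix [W] can send the classes in [P] to the
    paying base model and the others to the zero one. *)
Lemma realizable_hop (T : finType) (s0 : T) H (g : T -> nat) d (P : pred nat)
    (L : {set T}) :
  (forall s, (g s < d)%N) -> (forall s, (s \in L) = P (g s)) ->
  realizable (hop_base s0 H) (@index_feature T T g d) (hop R s0 H L).
Proof.
move=> gd LP; split=> //.
pose kof (j : nat) : 'I_2 := if P j then ord_max else ord0.
exists (\matrix_(k, j) (k == kof j)%:R); split.
- by move=> k i; rewrite mxE ler0n lern1 leq_b1.
- move=> j; rewrite -[RHS](is_distr_delta R (kof j)).2.
  by apply: eq_bigr => k _; rewrite mxE.
(* Both base models have the same transitions, so weights summing to 1 reproduce them. *)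
- move=> s a s'; transitivity (1 * (s' == a)%:R : R); first by rewrite mul1r.
  rewrite -[X in X * _](is_distr_delta R (kof (g s))).2 mulr_suml.
  by apply: eq_bigr => k _; rewrite (mulmx_index_feature _ _ (gd s)) mxE.
- move=> s a B mB.
  under eq_bigr do rewrite (mulmx_index_feature _ _ (gd s)) mxE.
  rewrite sum_deltaE /= /hop_reward LP /kof.
  by case: (P _); rewrite ?finset.in_set0 ?finset.in_setT.
Qed.

End Realizability.

(** * Polynomial budgets against [H ^ H] *)

Lemma eval5_bound (R : realType) (f : mpoly.mpoly 5 R) :
  exists C D : nat, forall H, (0 < H)%N ->
    eval5 f 1 H 2 4^-1 4^-1 <= (C * H ^ D)%:R.
Proof.
(* The arguments 1, [H], 2, 4, 4 all lie between 0 and [4 * H], so [f] is at most [c * (4 * H) ^ D],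
   with [D] the largest total degree of a monomial and [c] the sum of the absolute values of the
   coefficients. *)
pose mon := tnth (in_tuple (mpoly.msupp f)).
pose D := (\max_j \sum_i mpoly.fun_of_multinom (mon j) i)%N.
pose c := \sum_j `|mpoly.mcoeff (mon j) f|.
exists (Num.bound c * 4 ^ D)%N, D => H H0.
rewrite /eval5; set v := (X in mpoly.meval X f); rewrite mpoly.mevalE big_tnth.
have v4H i : 0 <= v i <= (4 * H)%:R.
  rewrite /v; case: i; do 5 (case; first by move=> _ /=;
    rewrite ?invrK ?ler0n ?ler_nat; lia); by [].
apply: (@le_trans _ _ (c * (4 * H)%:R ^+ D)); last first.
  rewrite -mulnA -expnMn [leRHS]natrM natrX ler_wpM2r ?exprn_ge0//.
  by rewrite ltW// archi_boundP// sumr_ge0.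
rewrite /c mulr_suml; apply: ler_sum => j _; rewrite -/(mon j); set m := mon j.
apply: (le_trans (ler_norm _)); rewrite normrM ler_wpM2l//.
rewrite ger0_norm; last first.
  by apply: prodr_ge0 => i _; rewrite exprn_ge0//; case/andP: (v4H i).
apply: (@le_trans _ _ (\prod_i (4 * H)%:R ^+ mpoly.fun_of_multinom m i)).
  apply: ler_prod => i _; have /andP[v0 v1] := v4H i.
  by rewrite exprn_ge0// lerXn2r// nnegrE.
rewrite -expr_sum -!natrX ler_nat leq_pexp2l ?muln_gt0//.
exact: leq_bigmax.
Qed.

Lemma self_power_dominates (C D : nat) :
  exists2 H, (1 < H)%N & (2 * (H * ((C * H ^ D) ^ 2).+1) < H ^ H)%N.
Proof.
(* This [H] exceeds [2 * C ^ 2 + 2], which absorbs the constant into one more factor [H], and is at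
   least [2 * D + 2], the resulting exponent. *)
pose H := (2 * C ^ 2 + 2 * D + 3)%N; exists H; first lia.
have H0 : (0 < H)%N by lia.
have le1 : (2 * (H * ((C * H ^ D) ^ 2).+1) <= (2 * C ^ 2 + 2) * H ^ (2 * D).+1)%N.
  have : (1 <= H ^ (2 * D))%N by rewrite expn_gt0 H0.
  rewrite expnMn -expnM (mulnC D) (expnS H); set h := (H ^ _)%N => h1.
  have : (H <= H * h)%N by rewrite leq_pmulr.
  rewrite mulnS mulnCA; move: (C ^ 2)%N (H * h)%N => q k; lia.
apply: (leq_ltn_trans le1); apply: (@leq_trans (H ^ (2 * D).+2)%N).
  by rewrite [X in (_ < X)%N]expnS ltn_pmul2r ?expn_gt0 ?H0//; lia.
by rewrite leq_pexp2l//; lia.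
Qed.

(** * The construction and the contradiction *)

Theorem proposition5p2 (R : realType) :
  exists (S A : nat -> finType)
         (Mb : forall H : nat, 'I_2 -> mdp R (S H) (A H))
         (d : nat -> 'I_2 -> nat)
         (phi : forall (H : nat) (i : 'I_2), S H -> A H -> 'cV[R]_(d H i)),
    (forall H : nat, (1 <= H)%N ->
       [/\ (0 < #|A H|)%N,
           forall k l s, init (Mb H k) s = init (Mb H l) s,
           forall k, unit_return (Mb H k) H,
           forall i, is_state_partition (phi H i) &
           nested (phi H)])
    /\
    ~ (exists (f : mpoly.mpoly 5 R)
              (alg : forall (H : nat) (eps delta : R),
                 algorithm R (S H) (A H) H),
         forall (H : nat) (eps delta : R) (M : mdp R (S H) (A H)) (ds : nat),
           (1 <= H)%N -> 0 < eps < 1 -> 0 < delta < 1 ->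
           unit_return M H ->
           (exists i, realizable (Mb H) (phi H i) M) ->
           is_dstar (Mb H) (phi H) M ds ->
           exists n : nat,
             n%:R <= eval5 f ds H 2 eps delta /\
             ((1 - delta)%:E <=
                prob_output M (alg H eps delta) (eps_optimal M eps) n [::])%E).
Proof.
pose T H : finType := 'I_(H ^ H).+1.
pose d H (i : 'I_2) := if i == ord0 then 1%N else (H ^ H).+1.
pose g H (i : 'I_2) (s : T H) : nat := if i == ord0 then 0%N else s.
have gd H i s : (g H i s < d H i)%N by rewrite /g /d; case: ifP.
pose Mb H := @hop_base R (T H) ord0 H.
pose phi H i := @index_feature R (T H) (T H) (g H i) (d H i).
have rM0 H : realizable (Mb H) (phi H ord0) (hop R ord0 H finset.set0).
  by apply: (@realizable_hop _ _ _ _ _ _ pred0) => // s; rewrite finset.in_set0.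
have rMl H l :
    realizable (Mb H) (phi H ord_max) (hop R ord0 H [set l]%SET).
  apply: (@realizable_hop _ _ _ _ _ _ (pred1 (val l))) => // s.
  by rewrite finset.in_set1.
exists T, T, Mb, d, phi; split=> [H H1|[f [alg algP]]].
  split=> //.
  - by rewrite card_ord.
  - by move=> k; exact: unit_return_hop.
  - move=> i; apply: (@index_feature_state_partition R _ (T H) ord0) => // j.
    rewrite /g; move: j; rewrite /d; case: ifP => _ j; last by exists j.
    by exists ord0; rewrite (ord1 j).
  (* For [i <= j], either [j] is the fine index, whose class determines the state, or both are the
     coarse one. *)
  - move=> i j ij; have ji0 : (j == ord0) ==> (i == ord0).
      by apply/implyP => /eqP j0; move: ij; rewrite j0 leqn0.
    split; first by rewrite /d; case: (i == ord0) ji0; case: (j == ord0).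
    move=> s a s' a' /(@index_feature_inj _ _ _ _ _ _ _ a a' (gd H j s)).
    rewrite /phi /index_feature; suff gij : g H j s = g H j s' ->
      g H i s = g H i s' by move=> /gij ->.
    by rewrite /g; case: (i == ord0) ji0; case: (j == ord0).
have [C [D fP]] := eval5_bound f.
have [H H1 HCD] := self_power_dominates C D.
have e4 : 0 < (4^-1 : R) < 1 by lra.
(* The algorithm is fixed before the environment is chosen, so the same [a] faces every model
   below. *)
set a := alg H 4^-1 4^-1.
have [||n [nf out0]] := algP H _ _ _ 1%N (ltnW H1) e4 e4
  (unit_return_hop R ord0 (H := H) finset.set0).
- by exists ord0.
- split; first by exists ord0.
  by move=> i _; rewrite /d; case: ifP.
have nCD : (n <= C * H ^ D)%N.
  by rewrite -(ler_nat R) (le_trans nf)// fP// ltnW.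
(* The budget for paying state [l] may grow with a [d*] as large as [H ^ H + 1]; only its finiteness
   is kept. Any [d*] will do, hence the case split on coarse realizability. *)
have /choice[m mP] l : exists m, 1 - 4^-1 <= hop_output ord0
    (hop_reward R H [set l]%SET) a
    (eps_optimal (hop R ord0 H [set l]%SET) 4^-1) m [::].
  have [ds dsP] : exists ds, is_dstar (Mb H) (phi H) (hop R ord0 H [set l]%SET) ds.
    have [r0|nr0] := pselect (realizable (Mb H) (phi H ord0)
      (hop R ord0 H [set l]%SET)).
      exists 1%N; split; first by exists ord0.
      by move=> i _; rewrite /d; case: ifP.
    exists (H ^ H).+1; split; first by exists ord_max.
    by move=> i ri; rewrite /d; case: eqVneq => // i0; case: nr0; rewrite -i0.
  have [|m [_ outl]] := algP H _ _ _ ds (ltnW H1) e4 e4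
    (unit_return_hop R ord0 (H := H) [set l]%SET) _ dsP; first by exists ord_max.
  by exists m; move: outl; rewrite prob_output_hop lee_fin.
have goodH (pi : policy (T H) (T H) H) : \sum_l
    (eps_optimal (hop R ord0 H [set l]%SET) 4^-1 pi)%:R <= H%:R :> R.
  apply: (@le_trans _ _ (\sum_l (l \in hop_path pi H ord0 0)%:R)).
    apply: ler_sum => l _; rewrite ler_nat.
    case: (boolP (eps_optimal _ _ _)) => // opt.
    rewrite (eps_optimal_hop_set1 H1 _ opt)//; lra.
  by rewrite (le_trans (sum_mem_le _ _))// ler_nat size_hop_path.
have := sum_hop_output_le ord0 a m n goodH.
have : (1 - 4^-1) *+ #|T H| <= \sum_l hop_output ord0
    (hop_reward R H [set l]%SET) a
    (eps_optimal (hop R ord0 H [set l]%SET) 4^-1) (m l) [::].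
  by rewrite -sumr_const; apply: ler_sum => l _; exact: mP.
move: out0; rewrite prob_output_hop lee_fin.
(* With zero rewards every policy is optimal, so success only means stopping within [n] episodes. *)
rewrite (_ : eps_optimal _ _ = predT); last first.
  by apply/funext => pi; rewrite eps_optimal_hop_set0//; lra.
have : (2 * (H * (n ^ 2).+1) < (H ^ H).+1)%N.
  apply: (leq_ltn_trans _ (ltn_trans HCD (ltnSn _))).
  by rewrite !leq_mul2l ltnS leq_sqr nCD !orbT.
rewrite -(ltr_nat R) natrM card_ord -mulr_natl.
set N : R := (H ^ H).+1%:R; set o := hop_output _ _ _ _ _ _.
have N0 : 0 <= N by [].
(* As [o] is at least 3/4, the counting inequality gives [N / 2 <= H * (n ^ 2 + 1)], against
   [2 * (H * (n ^ 2 + 1)) < N]. *)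
nra.
Qed.
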